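(* Let $X$ be a connected compact Hausdorff space and let $h=\mathrm{diag}(f_1,f_2,\dots,f_n)$ be a self-adjoint element of $M_n(C(X))$, where $f_1,\dots,f_n\colon X\to\mathbb R$ are continuous. For $x\in X$ let $\lambda_i(x)$ be the $i$-th lowest eigenvalue of $h(x)$ counted with multiplicity, $1\le i\le n$. Then for every $\varepsilon>0$ there is a unitary $u\in M_n(C(X))$ such that $$\|uhu^*-\mathrm{diag}(\lambda_1,\lambda_2,\dots,\lambda_n)\|<\varepsilon.$$
   Context: $M_n(C(X))$ is the $C^*$-algebra of $n\times n$ matrices over the algebra $C(X)$ of continuous complex-valued functions on $X$. The functions $\lambda_i$ are continuous on $X$. *)

(* Defs.v *)
From HB Require Import structures.
From mathcomp Require Import all_boot all_order all_algebra.
From mathcomp Require Import complex.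
From mathcomp Require Import all_classical all_reals all_analysis.

Set Implicit Arguments.
Unset Strict Implicit.
Unset Printing Implicit Defensive.

Import Order.TTheory GRing.Theory Num.Theory numFieldNormedType.Exports.

Local Open Scope classical_set_scope.
Local Open Scope ring_scope.
Local Open Scope complex_scope.

(* The complex numbers, typed so that the topology that MathComp-Analysis puts
   on every [numFieldType] is inferred. *)
Definition Cplx (R : realType) : numClosedFieldType := R[i].

Definition RtoC (R : realType) (x : R) : Cplx R := x%:C.

Lemma continuous_RtoC (R : realType) : continuous (@RtoC R).
Proof.
move=> x; apply/cvgrPdist_lt => -[a b]; rewrite ltcE /= => /andP[/eqP-> a0].
have : \forall y \near x, `|x - y| < a by exact: nbhsx_ballx.
apply: filterS => y xya.
have -> : `|RtoC x - RtoC y| = (`|x - y|)%:C.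
  by rewrite /RtoC -rmorphB /= normc_def /= expr0n /= addr0 sqrtr_sqr.
by rewrite ltcR.
Qed.

Lemma continuous_conjC (C : numClosedFieldType) :
  continuous (fun z : C => Num.conj z).
Proof.
move=> z; apply/(@cvgrPdist_lt _ C _ _ (nbhs_filter z)) => e e0.
apply: (@filterS _ (nbhs z)) (nbhsx_ballx z e e0) => w /= zwe.
by rewrite -rmorphB norm_conjC.
Qed.

Section continuous_pred.
Variables (X Y : topologicalType).

Definition contfun : {pred X -> Y} := mem [set f : X -> Y | continuous f].

Definition contfun_key : pred_key contfun. Proof. exact. Qed.
Canonical contfun_keyed := KeyedPred contfun_key.

Notation T := (continuousType X Y).

Section Sub.
Variables (f : X -> Y) (fP : f \in contfun).
Definition contfun_Sub : T := mkcts (set_mem fP).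
End Sub.

Lemma contfun_rect (K : T -> Type) :
  (forall f (Pf : f \in contfun), K (contfun_Sub Pf)) -> forall u : T, K u.
Proof.
move=> Ksub [f [[Pf]]]/=.
have := Ksub f (mem_set (Pf : [set f : X -> Y | continuous f] f)).
congr (K _); apply/continuousEP => x //.
Qed.

Lemma contfun_valP f (Pf : f \in contfun) : contfun_Sub Pf = f :> (_ -> _).
Proof. by []. Qed.

HB.instance Definition _ := isSub.Build _ _ T contfun_rect contfun_valP.

End continuous_pred.

Section continuous_ring.
Variables (R : realType) (X : topologicalType).

Lemma contfun_subring_closed : subring_closed (@contfun X (Cplx R)).
Proof.
split=> [|f g /set_mem fc /set_mem gc|f g /set_mem fc /set_mem gc].
- by apply/mem_set; exact: cst_continuous.
- apply/mem_set => x. exact: (@cvgB _ (Cplx R) _ _ _ f g _ _ (fc x) (gc x)).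
- apply/mem_set => x. exact: (@cvgM _ _ _ _ f g _ _ (fc x) (gc x)).
Qed.

HB.instance Definition _ := GRing.isSubringClosed.Build _
  (@contfun X (Cplx R)) contfun_subring_closed.
HB.instance Definition _ := GRing.SubChoice_isSubComPzRing.Build _ _
  (continuousType X (Cplx R)) (subringClosedP _).

End continuous_ring.

Notation CX R X := (continuousType X (Cplx R)).

Section matrices_over_CX.
Variables (R : realType) (X : topologicalType) (n : nat).
Implicit Types (g : CX R X) (A : 'M[CX R X]_n) (f : 'I_n -> continuousType X R).

Lemma continuous_conj_comp g : continuous (fun x => Num.conj (g x) : Cplx R).
Proof.
move=> x; apply: (@continuous_comp _ _ _ g (@Num.conj (Cplx R))).
  exact: cts_fun.
exact: continuous_conjC.
Qed.

Definition starCX g : CX R X := 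
  @mkcts X (Cplx R) (fun x => Num.conj (g x)) (@continuous_conj_comp g).

Definition adjCX A : 'M[CX R X]_n := (map_mx starCX A)^T.

Definition unitaryCX A : Prop := A *m adjCX A = 1%:M /\ adjCX A *m A = 1%:M.

Definition evalmx A (x : X) : 'M[Cplx R]_n := map_mx (fun g => g x) A.

Lemma continuous_RtoC_comp (g : continuousType X R) :
  continuous (fun x => RtoC (g x)).
Proof.
move=> x; apply: (@continuous_comp _ _ _ g (@RtoC R)).
  exact: cts_fun.
exact: continuous_RtoC.
Qed.

Definition RtoCX (g : continuousType X R) : CX R X :=
  @mkcts X (Cplx R) (fun x => RtoC (g x)) (@continuous_RtoC_comp g).

Definition diagCX f : 'M[CX R X]_n := diag_mx (\row_i RtoCX (f i)).

Lemma diagCX_selfadjoint f : adjCX (diagCX f) = diagCX f.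
Proof.
apply/matrixP => i j; rewrite !mxE eq_sym.
have [->|ij] := eqVneq i j; apply/continuousEP => x.
  by rewrite !mulr1n /= /mkcts; apply/eqP; rewrite /RtoC eq_complex /= oppr0 !eqxx.
by rewrite !mulr0n /= /mkcts; exact: conjC0.
Qed.

End matrices_over_CX.

Section norms.
Variables (R : realType) (n : nat).

Definition enorm (v : 'cV[Cplx R]_n) : R :=
  Num.sqrt (\sum_i ComplexField.Normc.normc (v i 0) ^+ 2).

Definition opnorm (M : 'M[Cplx R]_n) : R :=
  sup [set enorm (M *m v) | v in [set v | enorm v <= 1]].

(* For compact [X], this is the C*-norm of M_n(C(X)). *)
Definition normCX (X : topologicalType) (A : 'M[CX R X]_n) : R :=
  sup [set opnorm (evalmx A x) | x in [set: X]].

End norms.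

(* The eigenvalues in nondecreasing order, repeated with multiplicity, of a
   matrix with real spectrum such as a self-adjoint one; for such matrices
   [Re] only moves the roots of the characteristic polynomial from C to R. *)
Definition eigenvalues (R : realType) (n : nat) (M : 'M[Cplx R]_n) : seq R :=
  sort <=%R [seq complex.Re z
            | z : Cplx R <- sval (closed_field_poly_normal (char_poly M))].

Lemma eigenvalues_diag (R : realType) (X : topologicalType) (n : nat)
    (f : 'I_n -> continuousType X R) (x : X) :
  eigenvalues (evalmx (diagCX f) x) = sort <=%R [seq f i x | i : 'I_n].
Proof.
rewrite /eigenvalues; case: closed_field_poly_normal => r /=.
set M := evalmx _ _.
have -> : char_poly M = \prod_(z <- [seq RtoC (f i x) | i : 'I_n]) ('X - z%:P).
  rewrite char_poly_trig; last first.
    apply/is_trig_mxP => i j ij; rewrite !mxE /=.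
    by rewrite -val_eqE /= (ltn_eqF ij) mulr0n.
  rewrite big_image /=; apply: eq_bigr => i _.
  by rewrite !mxE eqxx mulr1n.
rewrite (monicP (monic_prod_XsubC _ _ _)) scale1r => /prod_XsubC_eq rE.
apply/perm_sort_leP; rewrite perm_sym.
have := perm_map (@complex.Re R) rE.
by rewrite -map_comp.
Qed.

(* Order statistics are 1-Lipschitz for the sup norm. *)
Lemma nth_sort_lt (R : realType) (n : nat) (a b : 'I_n -> R) (e : R) (i : 'I_n) :
  (forall j, b j < a j + e) ->
  nth 0 (sort <=%R [seq b j | j : 'I_n]) i <
  nth 0 (sort <=%R [seq a j | j : 'I_n]) i + e.
Proof.
move=> ab; set s := sort _ [seq a j | j : _]; set c := nth 0 s i.
have ss : size s = n by rewrite size_sort size_map size_enum_ord.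
have ilt : (i < count (<= c) s)%N.
  rewrite ltnNge; apply/negP => le_ci.
  have : c < nth 0 s i.
    by apply: nth_count_gt; rewrite ?le_ci ?ss ?ltn_ord ?sort_le_sorted.
  by rewrite ltxx.
apply: nth_count_lt; first exact: sort_le_sorted.
apply: leq_trans ilt _.
rewrite !count_sort !count_map.
by apply: sub_count => j /= ajc; apply: lt_le_trans (ab j) _; rewrite lerD2r.
Qed.

Section lambda.
Variables (R : realType) (X : topologicalType) (n : nat).
Variables (f : 'I_n -> continuousType X R) (i : 'I_n).

Lemma continuous_eigenvalue :
  continuous (fun x => nth 0 (eigenvalues (evalmx (diagCX f) x)) i : R).
Proof.
move=> x; apply/cvgrPdist_lt => e e0.
have : \forall y \near x, forall j, `|f j x - f j y| < e.
  apply: filter_forall => j.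
  have /cvgrPdist_lt := @cts_fun _ _ (f j) x.
  exact.
apply: filterS => y fxy; rewrite !eigenvalues_diag distrC ltr_distl.
rewrite ltrBlDr !nth_sort_lt // => j.
  by have := fxy j; rewrite ltr_distl ltrBlDr => /andP[].
by have := fxy j; rewrite distrC ltr_distl ltrBlDr => /andP[].
Qed.

(* Indices start at 0: [lambda i] is the (i+1)-st lowest eigenvalue. *)
Definition lambda : continuousType X R := 
  @mkcts X R (fun x => nth 0 (eigenvalues (evalmx (diagCX f) x)) i)
    continuous_eigenvalue.

End lambda.

(* Main.v *)
(* A pair of diagonal entries (a, b) is brought within d of (min a b, max a b)
   by a plane rotation depending continuously on (a, b): the identity if a <= b,
   close to a transposition if a - b is large compared with d, and in between
   a rotation by an intermediate angle, harmless because a and b are then close.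
   Approximate unitary equivalence is transitive, so the f_i can be sorted by
   compare-exchange steps; the pointwise sorted diagonal is the list of
   eigenvalues. *)
Require Import Defs.
From HB Require Import structures.
From mathcomp Require Import all_boot all_order all_algebra.
From mathcomp Require Import complex perm ring lra zify.
From mathcomp Require Import all_classical all_reals all_analysis.

Set Implicit Arguments.
Unset Strict Implicit.

Import Order.TTheory GRing.Theory Num.Theory numFieldNormedType.Exports.

Local Open Scope classical_set_scope.
Local Open Scope ring_scope.

(** * Plane rotations acting on diagonal matrices *)

Section rotation.
Variables (K : comPzRingType) (n : nat) (k m : 'I_n).

Definition rotation (c s : K) : 'M[K]_n := \matrix_(a, b)
  if a == k then (if b == k then c else if b == m then s else 0)
  else if a == m then (if b == k then - s else if b == m then c else 0)
  else (a == b)%:R.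

Hypothesis km : k != m.

Lemma rotation_conj_diag (c s : K) (d : 'rV[K]_n) (a b : 'I_n) :
  (rotation c s *m diag_mx d *m (rotation c s)^T) a b =
  if a == k then
    if b == k then c * c * d 0 k + s * s * d 0 m
    else if b == m then c * s * (d 0 m - d 0 k) else 0
  else if a == m then
    if b == k then c * s * (d 0 m - d 0 k)
    else if b == m then s * s * d 0 k + c * c * d 0 m else 0
  else if a == b then d 0 a else 0.
Proof.
have mk : m != k by rewrite eq_sym.
rewrite mul_mx_diag !mxE (bigD1 k) //= (bigD1 m mk) /= !mxE.
rewrite !eqxx (negPf mk).
set T := \sum_(i | _) _.
(* Away from [k] and [m] the rotation is the identity, so the remaining sum is at most one diagonal
   term. *)
have -> : T = if (a != k) && (a != m) && (a == b) then d 0 a else 0.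
  rewrite /T; case: ifPn => [/andP[/andP[ak am] /eqP<-]|nab].
    rewrite (bigD1 a) ?ak //= !mxE (negPf ak) (negPf am) eqxx big1.
      by rewrite addr0 mul1r mulr1.
    move=> i /andP[_ ia]; rewrite !mxE (negPf ak) (negPf am).
    by rewrite [a == i]eq_sym (negPf ia) !mul0r.
  apply: big1 => i /andP[ik im]; rewrite !mxE (negPf ik) (negPf im).
  case: (eqVneq a k) => [|ak]; first by rewrite !mul0r.
  case: (eqVneq a m) => [|am]; first by rewrite !mul0r.
  case: (eqVneq b k) => [|bk]; first by rewrite !mulr0.
  case: (eqVneq b m) => [|bm]; first by rewrite !mulr0.
  case: (eqVneq a i) => [ai|]; last by rewrite !mul0r.
  case: (eqVneq b i) => [bi|]; last by rewrite !mulr0.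
  by move: nab; rewrite ak am ai bi eqxx.
case: (eqVneq a k) => [->|ak].
  rewrite /=; case: (eqVneq b k) => [_|bk]; first by ring.
  case: (eqVneq b m) => [_|bm]; first by ring.
  by rewrite mulr0n; ring.
case: (eqVneq a m) => [->|am].
  rewrite /=; case: (eqVneq b k) => [_|bk]; first by ring.
  case: (eqVneq b m) => [_|bm]; first by ring.
  by rewrite mulr0n; ring.
rewrite /=; case: (eqVneq a b) => [<-|_].
  by rewrite (negPf ak) (negPf am) mulr0n; ring.
by rewrite mulr0n; ring.
Qed.

(** This is conjugation of the constant diagonal 1: the off-diagonal entries carry the factor
    [d 0 m - d 0 k], which vanishes. *)
Lemma rotation_orthogonal (c s : K) : c * c + s * s = 1 ->
  rotation c s *m (rotation c s)^T = 1%:M.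
Proof.
move=> cs1; apply/matrixP => a b.
have := rotation_conj_diag c s (const_mx 1) a b.
rewrite diag_const_mx mulmx1 => ->; rewrite !mxE subrr mulr0 !mulr1.
rewrite [s * s + _]addrC cs1.
case: (eqVneq a k) => [->|ak].
  by rewrite [k == b]eq_sym; case: (b == k) => //; case: ifP.
case: (eqVneq a m) => [->|am]; last by case: (a == b).
rewrite [m == b]eq_sym; case: (eqVneq b k) => [->|_]; last by case: (b == m).
by rewrite (negPf km).
Qed.

End rotation.

(* The rotation by these weights is the identity if a <= b; otherwise
   cos * (a - b) = sin * d, so both the off-diagonal entry cos * sin * (a - b)
   and the diagonal error cos^2 * (a - b) are at most d. *)
Section exchange_weights.
Variables (R : realType) (d : R).
Hypothesis d0 : 0 < d.
Implicit Types a b : R.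

(** The positive part keeps the weights continuous where [a] and [b] cross; the summand [d * d] of
    the radius keeps its inverse defined there. *)
Definition exchange_gap a b : R := Num.max 0 (a - b).
Definition exchange_radius a b : R :=
  Num.sqrt (exchange_gap a b * exchange_gap a b + d * d).
Definition exchange_cos a b : R := d / exchange_radius a b.
Definition exchange_sin a b : R := exchange_gap a b / exchange_radius a b.

Lemma exchange_gap_ge0 a b : 0 <= exchange_gap a b.
Proof. by rewrite le_max lexx. Qed.

Lemma exchange_radius_gt0 a b : 0 < exchange_radius a b.
Proof. by rewrite sqrtr_gt0 ltr_wpDl ?mulr_ge0 ?mulr_gt0 ?exchange_gap_ge0. Qed.

Lemma exchange_cos2Dsin2 a b :
  exchange_cos a b * exchange_cos a b + exchange_sin a b * exchange_sin a b = 1.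
Proof.
have r0 := exchange_radius_gt0 a b.
have r2 : exchange_radius a b * exchange_radius a b =
    exchange_gap a b * exchange_gap a b + d * d.
  by rewrite -expr2 sqr_sqrtr // addr_ge0 ?mulr_ge0 ?exchange_gap_ge0 // ltW.
rewrite /exchange_cos /exchange_sin; apply/eqP.
rewrite !mulf_div -mulrDl r2 addrC divff // -r2.
by rewrite mulf_neq0 ?gt_eqF.
Qed.

Lemma exchange_weights_bounds a b (c := exchange_cos a b) (s := exchange_sin a b) :
  [/\ `|c * c * a + s * s * b - Num.min a b| <= d,
      `|s * s * a + c * c * b - Num.max a b| <= d &
      `|c * s * (b - a)| <= d].
Proof.
have r0 := exchange_radius_gt0 a b.
have p0 := exchange_gap_ge0 a b.
have cs1 : c * c + s * s = 1 := exchange_cos2Dsin2 a b.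
have c0 : 0 <= c by rewrite divr_ge0 // ltW.
have s0 : 0 <= s by rewrite divr_ge0 // ltW.
have cps : c * exchange_gap a b = s * d.
  by rewrite /c /s /exchange_cos /exchange_sin mulrAC [RHS]mulrAC [d * _]mulrC.
case: (leP a b) => ab.
  have pE : exchange_gap a b = 0 by apply/max_idPl; rewrite subr_le0.
  have sE : s = 0 by rewrite /s /exchange_sin pE mul0r.
  move: cs1; rewrite sE !mul0r !mulr0 !addr0 => ->.
  by rewrite !mul1r add0r !mul0r !subrr !normr0 ltW.
have pE : exchange_gap a b = a - b by apply/max_idPr; rewrite subr_ge0 ltW.
rewrite pE in cps p0; clearbody c s.
(* Trading one factor [c * (a - b)] for [s * d] turns every error into a product of two weights
   times [d], up to sign, and such products of weights are at most 1. *)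
have c2p : c * c * (a - b) = c * s * d by rewrite -mulrA cps mulrA.
have csp : c * s * (a - b) = s * s * d by rewrite mulrAC cps mulrAC.
have cs_le1 : c * s <= 1 by nra.
have s2_le1 : s * s <= 1 by nra.
have csd : 0 <= c * s * d <= d.
  by rewrite !mulr_ge0 ?(ltW d0) //= ler_piMl // ltW.
have ssd : 0 <= s * s * d <= d.
  by rewrite !mulr_ge0 ?(ltW d0) //= ler_piMl // ltW.
have -> : c * c * a + s * s * b - b = c * s * d.
  by rewrite -c2p -{2}[b]mul1r -cs1; ring.
have -> : s * s * a + c * c * b - a = - (c * s * d).
  by rewrite -c2p -{2}[a]mul1r -cs1; ring.
have -> : c * s * (b - a) = - (s * s * d) by rewrite -csp; ring.
rewrite !normrN.
by case/andP: csd => ? ?; case/andP: ssd => ? ?; rewrite !ger0_norm.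
Qed.

End exchange_weights.

(** * Pointwise evaluation and approximate unitary equivalence *)

Section evaluation.
Variables (R : realType) (X : topologicalType) (n : nat).
Implicit Types (A B u v : 'M[CX R X]_n) (x : X).

(** Evaluation gets a name so that it can carry a ring morphism structure, which makes the lemmas on
    [map_mx] apply to [evalmx]. *)
Definition evalCX x (g : CX R X) : Cplx R := g x.

Fact evalCX_is_zmod_morphism x : zmod_morphism (evalCX x).
Proof. by []. Qed.
HB.instance Definition _ x :=
  GRing.isZmodMorphism.Build _ _ (evalCX x) (evalCX_is_zmod_morphism x).

Fact evalCX_is_monoid_morphism x : monoid_morphism (evalCX x).
Proof. by []. Qed.
HB.instance Definition _ x :=
  GRing.isMonoidMorphism.Build _ _ (evalCX x) (evalCX_is_monoid_morphism x).

Lemma evalmxM A B x : evalmx (A *m B) x = evalmx A x *m evalmx B x.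
Proof. exact: (map_mxM (evalCX x)). Qed.

Lemma evalmxD A B x : evalmx (A + B) x = evalmx A x + evalmx B x.
Proof. exact: (map_mxD (evalCX x)). Qed.

Lemma evalmxB A B x : evalmx (A - B) x = evalmx A x - evalmx B x.
Proof. exact: (map_mxB (evalCX x)). Qed.

Lemma evalmx1 x : evalmx (1%:M : 'M[CX R X]_n) x = 1%:M.
Proof. exact: (map_mx1 (evalCX x)). Qed.

Lemma evalmx_adj A x : evalmx (adjCX A) x = (map_mx Num.conj (evalmx A x))^T.
Proof. by apply/matrixP => i j; rewrite !mxE. Qed.

Lemma evalmx_inj A B : (forall x, evalmx A x = evalmx B x) -> A = B.
Proof.
move=> AB; apply/matrixP => i j; apply/continuousEP => x.
by have /matrixP/(_ i j) := AB x; rewrite !mxE.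
Qed.

Lemma evalmx_diag (f : 'I_n -> continuousType X R) x :
  evalmx (diagCX f) x = map_mx (@RtoC R) (diag_mx (\row_i f i x)).
Proof.
apply/matrixP => i j; rewrite !mxE.
by case: (i == j).
Qed.

Lemma adjCXM A B : adjCX (A *m B) = adjCX B *m adjCX A.
Proof.
apply: evalmx_inj => x.
by rewrite evalmxM !evalmx_adj evalmxM map_mxM trmx_mul.
Qed.

Lemma unitaryCXM u v : unitaryCX u -> unitaryCX v -> unitaryCX (v *m u).
Proof.
move=> [u1 u2] [v1 v2]; rewrite /unitaryCX adjCXM; split.
  by rewrite mulmxA -(mulmxA v) u1 mulmx1.
by rewrite mulmxA -(mulmxA _ _ v) v2 mulmx1.
Qed.

(** The [(i, i)] entry of [u *m adjCX u = 1%:M] says that the squared moduli in row [i] sum to 1. *)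
Lemma unitaryCX_entry_le1 u x i j : unitaryCX u -> `|evalmx u x i j| <= 1.
Proof.
move=> [u1 _].
have /matrixP/(_ i i) : evalmx (u *m adjCX u) x = 1%:M by rewrite u1 evalmx1.
rewrite evalmxM evalmx_adj !mxE eqxx mulr1n (bigD1 j) //= => uu.
rewrite -(@expr_le1 _ 2) // -uu !mxE normCK lerDl.
apply: sumr_ge0 => l _; rewrite !mxE -normCK.
by rewrite exprn_ge0.
Qed.

(** Errors are measured entrywise and uniformly in [x], so that suprema enter only at the end, at
    the cost of a factor [n * n]. *)
Definition approx_equiv A B : Prop := forall e : R, 0 < e ->
  exists u, unitaryCX u /\
    forall x i j, `|evalmx (u *m A *m adjCX u - B) x i j| <= RtoC e.

Lemma approx_equiv_refl A : approx_equiv A A.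
Proof.
move=> e e0; exists 1%:M.
have adj1 : adjCX (1%:M : 'M[CX R X]_n) = 1%:M.
  by apply: evalmx_inj => x; rewrite evalmx_adj evalmx1 map_mx1 trmx1.
split; first by rewrite /unitaryCX adj1 mul1mx.
move=> x i j; rewrite adj1 mul1mx mulmx1 evalmxB subrr.
by rewrite mxE normr0 lecR ltW.
Qed.

(** The product [v *m u] works: the first error [E] gets conjugated by [v], whose entries have
    modulus at most 1, and is added to the second error. *)
Lemma approx_equiv_trans B A C :
  approx_equiv A B -> approx_equiv B C -> approx_equiv A C.
Proof.
move=> AB BC e e0.
have N0 : 0 < (n * n).+1%:R *+ 2 :> R by rewrite pmulrn_lgt0 ?ltr0n.
have [v [vU vBC]] := BC (e / 2) (divr_gt0 e0 (ltr0Sn R 1)).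
(* An entry of [v *m E *m adjCX v] has [n * n] terms, so this tolerance keeps it within [e / 2]; the
   successor avoids division by 0 when [n = 0]. *)
have [u [uU uAB]] := AB (e / ((n * n).+1%:R *+ 2)) (divr_gt0 e0 N0).
exists (v *m u); split; first exact: unitaryCXM.
move=> x i j; set E := u *m A *m adjCX u - B.
have -> : v *m u *m A *m adjCX (v *m u) - C =
    v *m E *m adjCX v + (v *m B *m adjCX v - C).
  by rewrite /E mulmxBr mulmxBl adjCXM !mulmxA addrA subrK.
rewrite evalmxD mxE.
apply: le_trans (ler_normD _ _) _.
have -> : RtoC e = RtoC (e / 2) + RtoC (e / 2) :> Cplx R.
  by rewrite /RtoC -rmorphD /= -splitr.
apply: lerD; last exact: vBC.
rewrite evalmxM evalmx_adj mxE.
apply: le_trans (ler_norm_sum _ _ _) _.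
set t := e / _ in uAB.
have ble l : `|(evalmx (v *m E) x i l) * (map_mx Num.conj (evalmx v x))^T l j| <=
   RtoC t *+ n.
  rewrite evalmxM normrM [_^T _ _]mxE [map_mx Num.conj _ _ _]mxE norm_conjC.
  rewrite [(_ *m _) _ _]mxE.
  apply: le_trans (ler_piMr _ (unitaryCX_entry_le1 x j l vU)) _ => //.
  apply: le_trans (ler_norm_sum _ _ _) _.
  rewrite -[n in _ *+ n]card_ord -sumr_const; apply: ler_sum => h _.
  rewrite normrM; apply: le_trans (ler_piMl _ (unitaryCX_entry_le1 x i h vU)) _ => //.
apply: le_trans (ler_sum _ (fun l _ => ble l)) _.
rewrite sumr_const card_ord -mulrnA /RtoC -rmorphMn /= lecR /t.
rewrite -[_ *+ (n * n)]mulr_natr -mulrA ler_pM2l //.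
rewrite -mulr_natr invfM mulrAC ler_piMl //.
by rewrite ler_pdivrMl ?ltr0n // mulr1 ler_nat.
Qed.

End evaluation.

(** * The compare-exchange step over C(X) *)

Section compare_exchange.
Variables (R : realType) (X : topologicalType) (n : nat).
Implicit Types f g : 'I_n -> continuousType X R.

Lemma continuous_min_cts (g h : continuousType X R) : 
  continuous (fun x => Num.min (g x) (h x) : R).
Proof.
by move=> x; apply: continuous_min; exact: cts_fun.
Qed.

Lemma continuous_max_cts (g h : continuousType X R) : 
  continuous (fun x => Num.max (g x) (h x) : R).
Proof.
by move=> x; apply: continuous_max; exact: cts_fun.
Qed.

Definition min_cts (g h : continuousType X R) : continuousType X R :=
  @mkcts X R _ (@continuous_min_cts g h).

Definition max_cts (g h : continuousType X R) : continuousType X R :=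
  @mkcts X R _ (@continuous_max_cts g h).

Definition compare_exchange (k m : 'I_n) f (l : 'I_n) : continuousType X R :=
  if l == k then min_cts (f k) (f m)
  else if l == m then max_cts (f k) (f m)
  else f l.

Lemma compare_exchangeE k m f l x : compare_exchange k m f l x =
  if l == k then Num.min (f k x) (f m x)
  else if l == m then Num.max (f k x) (f m x) else f l x.
Proof. by rewrite /compare_exchange; case: ifP => // _; case: ifP. Qed.

Lemma continuous_exchange_gap (g h : continuousType X R) :
  continuous (fun x => exchange_gap (g x) (h x) : R).
Proof.
move=> x; apply: (@continuous_max R X (fun=> 0) (fun x => g x - h x)).
  exact: cst_continuous.
by apply: (@continuousB _ R^o); exact: cts_fun.
Qed.

Lemma continuous_exchange_radius d (g h : continuousType X R) :
  continuous (fun x => exchange_radius d (g x) (h x) : R).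
Proof.
move=> x; apply: (@continuous_comp X R R (fun x =>
    exchange_gap (g x) (h x) * exchange_gap (g x) (h x) + d * d)
  Num.sqrt).
  apply: (@continuousD _ R^o); last exact: cst_continuous.
  by apply: continuousM; exact: continuous_exchange_gap.
exact: sqrt_continuous.
Qed.

Variables (d : R) (d0 : 0 < d).

Lemma continuous_exchange_cos (g h : continuousType X R) :
  continuous (fun x => exchange_cos d (g x) (h x) : R).
Proof.
move=> x; apply: (@continuousM R X (fun=> d)
  (fun x => (exchange_radius d (g x) (h x))^-1)).
  exact: cst_continuous.
apply: continuousV; last exact: continuous_exchange_radius.
by rewrite gt_eqF ?exchange_radius_gt0.
Qed.

Lemma continuous_exchange_sin (g h : continuousType X R) :
  continuous (fun x => exchange_sin d (g x) (h x) : R).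
Proof.
move=> x; apply: (@continuousM R X (fun x => exchange_gap (g x) (h x))
  (fun x => (exchange_radius d (g x) (h x))^-1)).
  exact: continuous_exchange_gap.
apply: continuousV; last exact: continuous_exchange_radius.
by rewrite gt_eqF ?exchange_radius_gt0.
Qed.

Definition exchange_unitary (k m : 'I_n) f : 'M[CX R X]_n :=
  rotation k m (RtoCX (@mkcts X R _ (@continuous_exchange_cos (f k) (f m))))
               (RtoCX (@mkcts X R _ (@continuous_exchange_sin (f k) (f m)))).

Lemma evalmx_exchange_unitary k m f x : evalmx (exchange_unitary k m f) x =
  map_mx (@RtoC R) (rotation k m (exchange_cos d (f k x) (f m x))
    (exchange_sin d (f k x) (f m x))).
Proof.
apply/matrixP => a b; rewrite !mxE.
case: ifP => _; first by case: ifP => // _; case: ifP.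
case: ifP => _; last by case: (a == b).
case: ifP => _; last by case: ifP.
by rewrite [RHS]rmorphN.
Qed.

(** The weights are real, so conjugation disappears and only the transpose remains. *)
Lemma evalmx_adj_exchange_unitary k m f x :
  evalmx (adjCX (exchange_unitary k m f)) x =
  map_mx (@RtoC R) (rotation k m (exchange_cos d (f k x) (f m x))
    (exchange_sin d (f k x) (f m x)))^T.
Proof.
rewrite evalmx_adj evalmx_exchange_unitary -map_trmx; congr trmx.
apply/matrixP => a b; rewrite !mxE.
by apply/eqP; rewrite eq_complex /= oppr0 !eqxx.
Qed.

End compare_exchange.

(** * Sorting the diagonal by compare-exchange steps *)

Section sorting.
Variables (R : realType) (X : topologicalType) (n : nat).
Implicit Types f g : 'I_n -> continuousType X R.

(** The tolerance [e] itself serves as the parameter [d] of the weights. At each point all matrices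
    are images of real ones under [RtoC], so the error is a real computation. *)
Lemma approx_equiv_compare_exchange (k m : 'I_n) f : k != m ->
  approx_equiv (diagCX f) (diagCX (compare_exchange k m f)).
Proof.
move=> km e e0; exists (exchange_unitary e0 k m f); split.
  have uu : exchange_unitary e0 k m f *m
      adjCX (exchange_unitary e0 k m f) = 1%:M.
    apply: evalmx_inj => x.
    rewrite evalmxM evalmx_exchange_unitary evalmx_adj_exchange_unitary evalmx1.
    by rewrite -map_mxM rotation_orthogonal ?map_mx1 // exchange_cos2Dsin2.
  (* Over a commutative ring a one-sided inverse of a square matrix is two-sided. *)
  by split=> //; exact: mulmx1C.
move=> x i j; rewrite evalmxB !evalmxM.
rewrite evalmx_exchange_unitary evalmx_adj_exchange_unitary !evalmx_diag.
rewrite -!map_mxM -map_mxB mxE.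
have normRtoC (y : R) : `|RtoC y| = RtoC `|y|.
  by rewrite /RtoC normc_def /= expr0n /= addr0 sqrtr_sqr.
rewrite normRtoC lecR mxE rotation_conj_diag // !mxE !compare_exchangeE.
(* These bound the entries with both indices in [{k, m}]; all other entries have error 0. *)
have [kk mm kmo] := exchange_weights_bounds e0 (f k x) (f m x).
have le0 : `|0 : R| <= e by rewrite normr0 ltW.
case: (eqVneq i k) => [->|ik].
  rewrite [k == j]eq_sym; case: (eqVneq j k) => _ //.
  by rewrite mulr0n subr0; case: ifP.
case: (eqVneq i m) => [->|im].
  rewrite [m == j]eq_sym; case: (eqVneq j k) => [->|_].
    by rewrite (negPf km) mulr0n subr0.
  case: (eqVneq j m) => _ //.
  by rewrite mulr0n subr0.
by case: (i == j); rewrite ?mulr1n ?mulr0n subrr.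
Qed.

(** At a given point the exchange either fixes all values or applies [tperm k m]; which of the two
    occurs depends on [x]. *)
Lemma perm_compare_exchange (k m : 'I_n) f x : k != m ->
  perm_eq [seq compare_exchange k m f l x | l : 'I_n]
          [seq f l x | l : 'I_n].
Proof.
move=> km; rewrite /image_mem; have [fkm|fmk] := leP (f k x) (f m x).
  rewrite (eq_map (_ : _ =1 f^~ x)) // => l.
  rewrite compare_exchangeE (min_idPl fkm) (max_idPr fkm).
  by case: eqP => [->|_] //; case: eqP => [->|].
have E l : compare_exchange k m f l x = f (tperm k m l) x.
  rewrite compare_exchangeE (min_idPr (ltW fmk)) (max_idPl (ltW fmk)).
  by rewrite permE /=; case: eqP => // _; case: eqP.
rewrite (eq_map E) (map_comp (f^~ x) (tperm k m)); apply: perm_map.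
apply: uniq_perm; rewrite ?(map_inj_uniq perm_inj) ?enum_uniq // => l.
by rewrite mem_enum -[l](tpermK k m) map_f ?mem_enum.
Qed.

(** The order of the comparisons does not depend on [x], so one finite chain of exchanges of
    continuous functions sorts the values at all points at once. *)
Lemma exists_sorted f : exists g,
  [/\ approx_equiv (diagCX f) (diagCX g),
      forall x, perm_eq [seq g l x | l : 'I_n] [seq f l x | l : 'I_n] &
      forall (i j : 'I_n) x, (i < j)%N -> g i x <= g j x].
Proof.
(* After stage (k, m) of the exchange sort, rows i < k are below all later ones
   and row k is below the rows j with k < j < m. *)
pose stage k m g := [/\ approx_equiv (diagCX f) (diagCX g),
  forall x, perm_eq [seq g l x | l : 'I_n] [seq f l x | l : 'I_n] &
  forall (i j : 'I_n) x, (i < j)%N -> (i < k)%N || ((i == k :> nat) && (j < m)%N) ->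
  g i x <= g j x].
suff /(_ n) [g [gf gp gs]] : forall k, exists g, stage k 0 g.
  by exists g; split=> // i j x ij; apply: gs; rewrite ?ltn_ord.
elim=> [|k [g0 g0P]].
  by exists f; split=> //; [exact: approx_equiv_refl | move=> i j x; rewrite !ltn0 andbF].
(* Stage [(k, n)] already yields stage [(k.+1, 0)], since every index [j] is below [n]. *)
suff /(_ n) [g [gf gp gs]] : forall m, exists g, stage k m g.
  exists g; split=> // i j x ij.
  rewrite ltn0 andbF orbF ltnS leq_eqVlt => /orP ik; apply: gs => //.
  by case: ik => ->; rewrite ?ltn_ord ?orbT.
elim=> [|m [g [gf gp gs]]]; first by exists g0.
(* If [m <= k] or [n <= m], the next stage demands no new inequality. *)
have [/andP[km mn]|nkm] := boolP ((k < m)%N && (m < n)%N); last first.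
  exists g; split=> // i j x ij /orP[ik|/andP[/eqP ik jm]]; first by rewrite gs ?ik.
  apply: gs => //; rewrite ik eqxx ltnn /=.
  by move: nkm; rewrite -ik; have := ltn_ord j; lia.
pose K := Ordinal (ltn_trans km mn); pose M := Ordinal mn.
have KM : K != M by rewrite -val_eqE /= ltn_eqF.
exists (compare_exchange K M g); split.
- exact: approx_equiv_trans gf (approx_equiv_compare_exchange _ KM).
- by move=> x; apply: perm_trans (perm_compare_exchange _ _ KM) (gp x).
(* A row [i < k] is unchanged and lies below both exchanged values, hence below their minimum and
   maximum. *)
move=> i j x ij /orP[ik|/andP[/eqP ik jm]].
  rewrite !compare_exchangeE -!val_eqE /= ltn_eqF // ltn_eqF ?(ltn_trans ik) //.
  have gi (l : 'I_n) : (k <= l)%N -> g i x <= g l x.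
    by move=> kl; apply: gs; rewrite ?ik // (leq_trans ik).
  case: ifP => _; first by rewrite le_min !gi //= ltnW.
  by case: ifP => _; [rewrite le_max gi | apply: gs; rewrite ?ik].
(* Row [k] now holds the minimum: it is below the maximum in row [m], and it has not increased, so
   it stays below the unchanged rows between. *)
have -> : i = K by exact: val_inj.
rewrite ik in ij.
rewrite !compare_exchangeE eqxx -!val_eqE /= (gtn_eqF ij).
case: (eqVneq (j : nat) m) => [_|jm'].
  by rewrite le_max ge_min lexx.
have {jm'}jm : (j < m)%N by rewrite ltn_neqAle jm' -ltnS.
by rewrite ge_min gs //= eqxx jm orbT.
Qed.

Lemma sorted_lambda f g x (i : 'I_n) :
  perm_eq [seq g l x | l : 'I_n] [seq f l x | l : 'I_n] ->
  (forall i j : 'I_n, (i < j)%N -> g i x <= g j x) ->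
  lambda f i x = g i x.
Proof.
move=> gf gs; rewrite -[LHS]/(nth 0 (eigenvalues (evalmx (diagCX f) x)) i).
rewrite eigenvalues_diag -(perm_sort_leP _ _ gf).
rewrite sort_le_id; last first.
  rewrite sorted_map; apply: (@sub_sorted _ (relpre val ltn)) => [a b|]; first exact: gs.
  by rewrite -sorted_map val_enum_ord iota_ltn_sorted.
by rewrite (nth_map i) ?size_enum_ord // nth_ord_enum.
Qed.

(** The sorted diagonal equals the diagonal of eigenvalues exactly, so sorting is the only source of
    error. *)
Lemma approx_equiv_lambda f :
  approx_equiv (diagCX f) (diagCX (fun i => lambda f i)).
Proof.
have [g [gf gp gs]] := exists_sorted f.
suff -> : diagCX (fun i => lambda f i) = diagCX g by [].
apply: evalmx_inj => x; rewrite !evalmx_diag; congr (map_mx _ (diag_mx _)).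
apply/rowP => i; rewrite [LHS]mxE [RHS]mxE.
by apply: sorted_lambda => // a b; exact: gs.
Qed.

End sorting.

(** * From entrywise bounds to the norm *)

Section norm_bounds.
Variables (R : realType) (n : nat).

Lemma normc_ge0 (z : Cplx R) : 0 <= ComplexField.Normc.normc z.
Proof. by case: z => a b; exact: sqrtr_ge0. Qed.

(** Entries of a vector in the unit ball are at most 1 in modulus, so those of [M *m v] are at most
    [n%:R * e]; passing to the Euclidean norm costs the square root of [n], crudely bounded by
    [n]. *)
Lemma opnorm_le (M : 'M[Cplx R]_n) (e : R) : 0 <= e ->
  (forall i j, `|M i j| <= RtoC e) -> opnorm M <= n%:R * (n%:R * e).
Proof.
move=> e0 Me; apply: ge_sup.
  exists (enorm (M *m 0)), 0 => //=.
  rewrite /enorm big1 ?sqrtr0 // => i _.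
  by rewrite mxE ComplexField.Normc.normc0 expr0n.
move=> _ [v v1 <-].
have vle i : ComplexField.Normc.normc (v i 0) <= 1.
  apply: le_trans v1; rewrite /enorm.
  rewrite -[leLHS]ger0_norm ?normc_ge0 // -sqrtr_sqr.
  by rewrite ler_wsqrtr // (bigD1 i) //= lerDl sumr_ge0 // => j _; rewrite sqr_ge0.
have Mv i : ComplexField.Normc.normc ((M *m v) i 0) <= n%:R * e.
  rewrite -lecR -[leLHS]/(`|(M *m v) i 0 : Cplx R|) mxE.
  apply: le_trans (ler_norm_sum _ _ _) _.
  rewrite mulr_natl rmorphMn /= -[n in _ *+ n]card_ord -sumr_const.
  apply: ler_sum => j _; rewrite normrM.
  apply: le_trans (Me i j); apply: ler_piMr => //.
  by have := vle j; rewrite -lecR.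
rewrite /enorm -[leRHS]ger0_norm ?mulr_ge0 // -sqrtr_sqr ler_wsqrtr //.
have : \sum_i ComplexField.Normc.normc ((M *m v) i 0) ^+ 2 <= n%:R * (n%:R * e) ^+ 2.
  rewrite mulr_natl -[n in _ *+ n]card_ord -sumr_const; apply: ler_sum => i _.
  by rewrite lerXn2r ?nnegrE ?normc_ge0 ?mulr_ge0.
move/le_trans; apply; rewrite [leRHS]exprMn ler_wpM2r ?sqr_ge0 //.
by rewrite -natrX ler_nat; case: n => // p; rewrite leq_pmulr.
Qed.

Lemma normCX_le (X : topologicalType) (A : 'M[CX R X]_n) (e : R) : 0 <= e ->
  (forall x i j, `|evalmx A x i j| <= RtoC e) -> normCX A <= n%:R * (n%:R * e).
Proof.
move=> e0 Ae; rewrite /normCX.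
(* For empty [X] the supremum takes its default value 0. *)
have [->|] := eqVneq [set opnorm (evalmx A x) | x in [set: X]] set0.
  by rewrite sup0 !mulr_ge0.
move/set0P => ne; apply: ge_sup => // _ [x _ <-].
exact: opnorm_le.
Qed.

End norm_bounds.

Unset Implicit Arguments.
Set Strict Implicit.

Theorem lemma2p1 (R : realType) (X : topologicalType)
    (Xconn : connected [set: X]) (Xcomp : compact [set: X])
    (Xhaus : hausdorff_space X)
    (n : nat) (f : 'I_n -> continuousType X R) (eps : R) (eps_gt0 : 0 < eps) :
  let h : 'M[CX R X]_n := diagCX f in
  exists u : 'M[CX R X]_n,
    unitaryCX u /\
    normCX (u *m h *m adjCX u - diagCX (fun i => lambda f i)) < eps.
Proof.
move=> h.
(* The norm bound loses a factor [n * n]; dividing [eps] by its successor makes the final inequality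
   strict and covers [n = 0]. *)
have N0 : 0 < (n * n).+1%:R :> R by rewrite ltr0n.
have e0 := divr_gt0 eps_gt0 N0.
have [u [uU uh]] := approx_equiv_lambda f e0.
exists u; split=> //; apply: le_lt_trans (normCX_le (ltW e0) uh) _.
rewrite mulrA -natrM mulrA ltr_pdivrMr // mulrC ltr_pM2l //.
by rewrite ltr_nat.
Qed.
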